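(* Let $X$ be a locally compact Hausdorff space and $\overline{X}$ a compactification of $X$ such that $\overline{X}\setminus X$ is a $Z$-set in $\overline{X}$. Let $(X,\mathcal{B},\mathbf{b})$ be the coarse proximity structure on $X$ induced by the compactification $\overline{X}$. Then $$asInd(X)=Ind(\mathcal{U}X)=Ind(\overline{X}\setminus X).$$
   Context: A closed subset $A$ of a topological space $T$ is a $Z$-set in $T$ if there is a homotopy $H:T\times[0,1]\to T$ with $H(\cdot,0)=id_T$ and $H(T,t)\subseteq T\setminus A$ for all $t\in(0,1]$. Coarse proximity spaces. A bornology on a set $X$ is a family $\mathcal{B}$ of subsets of $X$ that contains all singletons, is closed under taking subsets, and is closed under unions of two members. Members of $\mathcal{B}$ are called bounded; other subsets of $X$ are unbounded. A coarse proximity space is a triple $(X,\mathcal{B},\mathbf{b})$ where $\mathcal{B}$ is a bornology on $X$ and $\mathbf{b}$ is a relation on the power set of $X$ such that for all $A,B,C\subseteq X$ (writing $\bar{\mathbf{b}}$ for the negation of $\mathbf{b}$): (1) $A\mathbf{b}B\Rightarrow B\mathbf{b}A$; (2) $A\mathbf{b}B\Rightarrow A,B\notin\mathcal{B}$; (3) $A\cap B\notin\mathcal{B}\Rightarrow A\mathbf{b}B$; (4) $(A\cup B)\mathbf{b}C\iff A\mathbf{b}C$ or $B\mathbf{b}C$; (5) $A\bar{\mathbf{b}}B\Rightarrow$ there is $E\subseteq X$ with $A\bar{\mathbf{b}}E$ and $(X\setminus E)\bar{\mathbf{b}}B$. A subset $Y\subseteq X$ carries the subspace coarse proximity structure: bornology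 $\{B\cap Y: B\in\mathcal{B}\}$, and $A\mathbf{b}_YC\iff A\mathbf{b}C$ for $A,C\subseteq Y$. The coarse proximity structure induced by a compactification $\overline{X}$ of a locally compact Hausdorff space $X$: $\mathcal{B}$ is the set of all $K\subseteq X$ with $cl_X(K)$ compact, and $A\mathbf{b}B\iff cl_{\overline{X}}(A)\cap cl_{\overline{X}}(B)\cap(\overline{X}\setminus X)\neq\emptyset$. Boundary. The discrete extension of $\mathbf{b}$ is the separated proximity $\delta$ on $X$ given by $A\delta B\iff(A\cap B\neq\emptyset$ or $A\mathbf{b}B)$. A cluster of $(X,\delta)$ is a collection $\sigma$ of nonempty subsets of $X$ such that $A\delta B$ for all $A,B\in\sigma$; if $C\delta A$ for all $A\in\sigma$ then $C\in\sigma$; and if $A\cup B\in\sigma$ then $A\in\sigma$ or $B\in\sigma$. The Smirnov compactification $\mathfrak{X}$ is the set of all clusters with the separated proximity $\delta^*$: $\mathcal{A}\delta^*\mathcal{C}$ iff $A\delta C$ for all $A,C\subseteq X$ such that $A\in\sigma$ for every $\sigma\in\mathcal{A}$ and $C\in\sigma$ for every $\sigma\in\mathcal{C}$. Its topology (closure of $\mathcal{A}$ is $\{\sigma:\{\sigma\}\delta^*\mathcal{A}\}$) is compact Hausdorff, and $X$ is identified with the dense set of point clusters (those containing a singleton); then $cl_{\mathfrak{X}}(A)=\{\sigma\in\mathfrak{X}:A\in\sigma\}$ for $A\subseteq X$. The boundary $\mathcal{U}X\subseteq\mathfrak{X}$ is the subspace of clusters containing no bounded set (it is compact Hausdorff).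 The trace of $A\subseteq X$ is $A'=cl_{\mathfrak{X}}(A)\cap\mathcal{U}X$. Dimensions. A separator between disjoint subsets $A,B$ of a topological space $T$ is a set $C\subseteq T$ such that $T\setminus C=U\cup V$ with $U,V$ disjoint open in $T$, $A\subseteq U$, $B\subseteq V$. The large inductive dimension of a normal space $T$: $Ind(T)=-1$ iff $T=\emptyset$; for $n\ge 0$, $Ind(T)\le n$ if for every pair of disjoint closed $A,B\subseteq T$ there is a separator $C$ between them with $Ind(C)\le n-1$; $Ind(T)=n$ if $n\ge -1$ is the smallest integer with $Ind(T)\le n$; $Ind(T)=\infty$ if there is no such integer. If $A\bar{\mathbf{b}}B$ in $X$, an asymptotic separator between $A$ and $B$ is a set $C\subseteq X$ such that $C'$ is a separator in $\mathcal{U}X$ between $A'$ and $B'$. The asymptotic inductive dimension: $asInd(X)=-1$ iff $X$ is bounded; for $n\ge0$, $asInd(X)\le n$ if for all $A,B\subseteq X$ with $A\bar{\mathbf{b}}B$ there is an asymptotic separator $C\subseteq X$ between $A$ and $B$ with $asInd(C)\le n-1$ ($C$ with the subspace coarse proximity structure); $asInd(X)=n$ if $n\ge-1$ is the smallest integer with $asInd(X)\le n$; $asInd(X)=\infty$ if there is no such integer. *)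

(* Defs.v *)
From HB Require Import structures.
From mathcomp Require Import all_boot all_order all_algebra.
From mathcomp Require Import all_classical all_reals all_analysis.
Import Order.TTheory GRing.Theory Num.Theory.
Import numFieldNormedType.Exports.

Set Implicit Arguments.
Unset Strict Implicit.
Unset Printing Implicit Defensive.

Local Open Scope classical_set_scope.
Local Open Scope ring_scope.

(* Only the values of H on T * [0, 1] matter. *)
Definition Zset (R : realType) (T : topologicalType) (A : set T) : Prop :=
  closed A /\
  exists H : T * R -> T,
    [/\ {within [set: T] `*` `[0, 1], continuous H},
        forall x, H (x, 0) = x &
        forall x t, 0 < t <= 1 -> ~ A (H (x, t))].

(* f is injective and the topology of X is the initial one; in particular f is
   continuous. *)
Definition embedding (X Y : topologicalType) (f : X -> Y) : Prop :=
  injective f /\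
  forall U : set X, open U <-> exists2 V : set Y, open V & f @^-1` V = U.

Definition is_compactification (X Y : topologicalType) (i : X -> Y) : Prop :=
  [/\ compact [set: Y], hausdorff_space Y, embedding i & dense (range i)].

Definition remainder (X Y : topologicalType) (i : X -> Y) : set Y :=
  ~` range i.

Record coarse_proximity (X : Type) := CoarseProximity {
  bdd : set (set X);
  cnear : set X -> set X -> Prop;
  bdd1 : forall x, bdd [set x];
  bddS : forall A B, A `<=` B -> bdd B -> bdd A;
  bddU : forall A B, bdd A -> bdd B -> bdd (A `|` B);
  cnearC : forall A B, cnear A B -> cnear B A;
  cnear_unbdd : forall A B, cnear A B -> ~ bdd A /\ ~ bdd B;
  cnearI : forall A B, ~ bdd (A `&` B) -> cnear A B;
  cnearU : forall A B C, cnear (A `|` B) C <-> cnear A C \/ cnear B C;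
  cnear_split : forall A B, ~ cnear A B ->
    exists E, ~ cnear A E /\ ~ cnear (~` E) B }.

Section CoarseProximityTheory.
Variables (X : Type) (P : coarse_proximity X).
Implicit Types A B C D : set X.

Lemma cnearS A B C D : A `<=` B -> C `<=` D -> cnear P A C -> cnear P B D.
Proof.
move=> AB CD AC.
have BC : cnear P B C by rewrite -(setUidr AB); apply/cnearU; left.
apply: cnearC; rewrite -(setUidr CD); apply/cnearU; left.
exact: cnearC.
Qed.

End CoarseProximityTheory.

Section Subspace.
Variables (X : Type) (P : coarse_proximity X) (Y : set X).

(* Subsets of Y are represented as sets over the subtype Y; the preimage of B
   under set_val is B `&` Y. *)
Definition sub_bdd : set (set Y) :=
  [set D | exists2 B, bdd P B & D = set_val @^-1` B].
Definition sub_cnear (A C : set Y) : Prop :=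
  cnear P (set_val @` A) (set_val @` C).

Local Lemma sub_bddP (D : set Y) : sub_bdd D <-> bdd P (set_val @` D).
Proof.
split=> [[B bB ->]|bD].
  by apply: (bddS _ bB) => _ [x Bx <-].
exists (set_val @` D) => //; apply/seteqP; split=> [x Dx|x [y Dy /val_inj <-//]].
by exists x.
Qed.

Local Lemma sub_bdd1 x : sub_bdd [set x].
Proof. by apply/sub_bddP; rewrite image_set1; exact: bdd1. Qed.

Local Lemma sub_bddS A B : A `<=` B -> sub_bdd B -> sub_bdd A.
Proof.
by move=> AB /sub_bddP bB; apply/sub_bddP/(bddS _ bB)/image_subset.
Qed.

Local Lemma sub_bddU A B : sub_bdd A -> sub_bdd B -> sub_bdd (A `|` B).
Proof.
move=> /sub_bddP bA /sub_bddP bB; apply/sub_bddP.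
by rewrite image_setU; exact: bddU.
Qed.

Local Lemma sub_cnearC A B : sub_cnear A B -> sub_cnear B A.
Proof. exact: cnearC. Qed.

Local Lemma sub_cnear_unbdd A B : sub_cnear A B -> ~ sub_bdd A /\ ~ sub_bdd B.
Proof. by move=> /cnear_unbdd[nA nB]; split=> /sub_bddP. Qed.

Local Lemma sub_cnearI A B : ~ sub_bdd (A `&` B) -> sub_cnear A B.
Proof.
move=> nAB; apply: cnearI => bAB; apply/nAB/sub_bddP/(bddS _ bAB).
by move=> _ [x [Ax Bx] <-]; split; exists x.
Qed.

Local Lemma sub_cnearU A B C :
  sub_cnear (A `|` B) C <-> sub_cnear A C \/ sub_cnear B C.
Proof. by rewrite /sub_cnear image_setU; exact: cnearU. Qed.

Local Lemma sub_cnear_split A B : ~ sub_cnear A B ->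
  exists E, ~ sub_cnear A E /\ ~ sub_cnear (~` E) B.
Proof.
move=> /cnear_split[E [AE EB]]; exists (set_val @^-1` E); split.
- by apply: contra_not AE; apply: cnearS => // _ [x Ex <-].
- by apply: contra_not EB; apply: cnearS => // _ [x Ex <-].
Qed.

Definition subspace_proximity : coarse_proximity Y :=
  CoarseProximity sub_bdd1 sub_bddS sub_bddU sub_cnearC sub_cnear_unbdd
    sub_cnearI sub_cnearU sub_cnear_split.

End Subspace.

Section Induced.
Variables (X Y : topologicalType) (i : X -> Y).
Hypotheses (lcX : locally_compact [set: X]) (hi : is_compactification i).

Definition induced_bdd : set (set X) := [set K | compact (closure K)].
Definition induced_cnear (A B : set X) : Prop :=
  closure (i @` A) `&` closure (i @` B) `&` remainder i !=set0.

Local Lemma compY : compact [set: Y]. Proof. by case: hi. Qed.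
Local Lemma hausY : hausdorff_space Y. Proof. by case: hi. Qed.
Local Lemma inj_i : injective i. Proof. by case: hi => _ _ []. Qed.
Local Lemma open_i U : open U <-> exists2 V : set Y, open V & i @^-1` V = U.
Proof. by case: hi => _ _ []. Qed.
Local Lemma dense_i : dense (range i). Proof. by case: hi. Qed.

Local Lemma cont_i : continuous i.
Proof. by apply/continuousP => V oV; apply/open_i; exists V. Qed.

Local Lemma image_compact (K : set X) : compact K -> compact (i @` K).
Proof.
by move=> cK; apply: continuous_compact cK; exact: continuous_subspaceT cont_i.
Qed.

Lemma induced_bddP (A : set X) :
  induced_bdd A <-> closure (i @` A) `<=` range i.
Proof.
split=> [cA|cA].
  apply: (@subset_trans _ (i @` closure A)); last first.
    by move=> _ [x _ <-]; exists x.
  have /closure_id -> := compact_closed hausY (image_compact cA).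
  exact/closureS/image_subset/subset_closure.
have cK : compact (closure (i @` A)).
  by apply: (subclosed_compact _ compY) => //; exact: closed_closure.
have clAP x : closure (i @` A) (i x) <-> closure A x.
  split=> clx.
    move=> U; rewrite nbhsE => -[W [/open_i[V oV <-] Vx] WU].
    have [_ [[a Aa <-] Va]] := clx V (open_nbhs_nbhs (conj oV Vx)).
    by exists a; split=> //; exact: WU.
  by move=> V /cont_i /clx[a [Aa Va]]; exists (i a); split=> //; exists a.
move=> F FF FA.
have FiA : (i @ F) (closure (i @` A)).
  by apply: (@filterS _ F _ (closure A) _ _ FA) => x /clAP.
have [y [cly Fy]] := cK (i @ F) _ FiA.
have [x _ xy] := cA y cly; move: cly Fy; rewrite -{}xy => /clAP clx Fx.
exists x; split=> // S U FS; rewrite nbhsE => -[W [/open_i[V oV <-] Vx] WU].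
have FiS : (i @ F) (i @` S).
  by apply: (@filterS _ F _ S _ _ FS) => s Ss; exists s.
have [_ [[s Ss <-] Vs]] := Fx _ V FiS (open_nbhs_nbhs (conj oV Vx)).
by exists s; split=> //; exact: WU.
Qed.

Lemma closed_remainder : closed (remainder i).
Proof.
apply: open_closedC; rewrite openE => _ [x _ <-].
have [K xK [cK clK]] := lcX (x := x) I.
have : nbhs x K by move: xK; rewrite withinET.
rewrite nbhsE => -[U [/open_i[V oV <-] Vx] UK].
rewrite /interior nbhsE; exists V => // y Vy.
suff : (i @` K) y by move=> [z _ <-]; exists z.
apply: (compact_closed hausY (image_compact cK)) => W.
rewrite nbhsE => -[W' [oW' W'y] W'W].
have [|z [[Vz W'z] [t _ tz]]] := @dense_i (V `&` W') _ (openI oV oW').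
  by exists y.
exists z; split; last exact: W'W.
by exists t => //; apply: UK; rewrite /= tz.
Qed.

Local Lemma induced_bdd1 x : induced_bdd [set x].
Proof.
apply/induced_bddP; rewrite image_set1 => y.
have /closure_id <- : closed [set i x].
  by apply: (compact_closed hausY); exact: compact_set1.
by move=> ->; exists x.
Qed.

Local Lemma induced_bddS A B : A `<=` B -> induced_bdd B -> induced_bdd A.
Proof.
move=> AB /induced_bddP bB; apply/induced_bddP.
exact/(subset_trans _ bB)/closureS/image_subset.
Qed.

Local Lemma induced_bddU A B :
  induced_bdd A -> induced_bdd B -> induced_bdd (A `|` B).
Proof. by rewrite /induced_bdd /= closureU; exact: compactU. Qed.

Local Lemma induced_cnearC A B : induced_cnear A B -> induced_cnear B A.
Proof. by rewrite /induced_cnear (setIC (closure (i @` A))). Qed.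

Local Lemma induced_cnear_unbdd A B :
  induced_cnear A B -> ~ induced_bdd A /\ ~ induced_bdd B.
Proof. by move=> [y [[Ay By] ry]]; split=> /induced_bddP h; apply/ry/h. Qed.

Local Lemma induced_cnearI A B : ~ induced_bdd (A `&` B) -> induced_cnear A B.
Proof.
move=> nAB; apply: contrapT => AB; apply/nAB/induced_bddP => y cy.
apply: contrapT => ry; apply: AB; exists y; split=> //.
by split; apply: closureS cy; apply: image_subset => x [].
Qed.

Local Lemma induced_cnearU A B C :
  induced_cnear (A `|` B) C <-> induced_cnear A C \/ induced_cnear B C.
Proof.
rewrite /induced_cnear image_setU closureU; split.
  by move=> [y [[[Ay|By] Cy] ry]]; [left|right]; exists y.
by move=> [[y [[Ay Cy] ry]]|[y [[By Cy] ry]]]; exists y; split=> //; split=> //;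
  [left|right].
Qed.

Local Lemma induced_cnear_split A B : ~ induced_cnear A B ->
  exists E, ~ induced_cnear A E /\ ~ induced_cnear (~` E) B.
Proof.
move=> nAB; pose Q := closure (i @` B) `&` remainder i.
pose P := closure (i @` A) `&` remainder i.
have cQ : closed Q by apply: closedI closed_remainder; exact: closed_closure.
have cP : closed P by apply: closedI closed_remainder; exact: closed_closure.
have QP : set_nbhs Q (~` P).
  apply/set_nbhsP; exists (~` P); split=> //; first exact: closed_openC.
  by move=> y [By ry] [Ay _]; apply: nAB; exists y.
have [W0 /set_nbhsP[W [oW QW WW0]] W0P] := compact_normal hausY compY cQ QP.
exists (i @^-1` W); split.
- move=> [y [[Ay Wy] ry]]; apply: (W0P y) => //.
  by apply: closureS Wy => _ [x Wx <-]; exact: WW0.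
- move=> [y [[Wy By] ry]].
  have : closure (~` W) y by apply: closureS Wy => _ [x Wx <-].
  by rewrite closure_setC; apply; move: oW; rewrite openE; apply; exact: QW.
Qed.

Definition induced_proximity : coarse_proximity X :=
  CoarseProximity induced_bdd1 induced_bddS induced_bddU induced_cnearC
    induced_cnear_unbdd induced_cnearI induced_cnearU induced_cnear_split.

End Induced.

Section Smirnov.
Variables (X : Type) (P : coarse_proximity X).
Implicit Types A B C D : set X.

Definition discrete_ext A B : Prop := A `&` B !=set0 \/ cnear P A B.

Definition is_cluster (s : set (set X)) : Prop :=
  [/\ forall A, s A -> A !=set0,
      forall A B, s A -> s B -> discrete_ext A B,
      forall C, (forall A, s A -> discrete_ext C A) -> s C &
      forall A B, s (A `|` B) -> s A \/ s B].

Definition smirnov : Type := {s : set (set X) | is_cluster s}.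

Definition smirnov_near (S T : set smirnov) : Prop :=
  forall A C, (forall s : smirnov, S s -> sval s A) ->
    (forall s : smirnov, T s -> sval s C) -> discrete_ext A C.

(* The complement of U contains its closure {s | {s} delta* ~` U}; that this
   operator is the closure of the resulting topology is closure_smirnov. *)
Definition smirnov_open : set (set smirnov) :=
  [set U | forall s, U s -> ~ smirnov_near [set s] (~` U)].

Lemma discrete_extC A B : discrete_ext A B -> discrete_ext B A.
Proof.
by move=> [AB|/cnearC]; [left; rewrite setIC|right].
Qed.

Lemma discrete_extS A B C D : A `<=` B -> C `<=` D ->
  discrete_ext A C -> discrete_ext B D.
Proof.
move=> AB CD [[x [/AB Bx /CD Dx]]|AC]; first by left; exists x.
by right; exact: cnearS AC.
Qed.

Lemma clusterS s A B : is_cluster s -> A `<=` B -> s A -> s B.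
Proof.
move=> [_ cl2 cl3 _] AB sA; apply: cl3 => C sC.
exact: discrete_extS (cl2 _ _ sA sC).
Qed.

Lemma smirnov_nearS (S S' T : set smirnov) :
  S `<=` S' -> smirnov_near T S -> smirnov_near T S'.
Proof. by move=> SS' TS A C TA S'C; apply: TS => // s /SS'; exact: S'C. Qed.

Lemma smirnov_near0 s : ~ smirnov_near [set s] set0.
Proof.
case: s => s cls; have [cl1 cl2 cl3 cl4] := cls => h.
have [A sA] : exists A, s A.
  apply: contrapT => ns; have [] := cl1 set0; last by [].
  by apply: cl3 => A sA; case: ns; exists A.
have [x Ax] := cl1 _ sA.
have [_ -> //||[y []//]|/cnear_unbdd[_]] := h A set0; first by [].
by apply; apply: bddS (bdd1 P x).
Qed.

Lemma smirnov_nearU s (S T : set smirnov) :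
  smirnov_near [set s] (S `|` T) ->
  smirnov_near [set s] S \/ smirnov_near [set s] T.
Proof.
case: s => s cls h; have [_ cl2 cl3 cl4] := cls.
apply: contrapT => /not_orP[nS nT].
have key (S' : set smirnov) :
    ~ smirnov_near [set exist _ s cls] S' ->
    exists2 C, (forall t, S' t -> sval t C) & ~ s C.
  move=> nS'; apply: contrapT => nC; apply: nS' => A C sA S'C.
  apply: contrapT => nAC; apply: nC; exists C => // sC; apply: nAC.
  by apply: cl2 => //; exact: (sA _ erefl).
have [C SC nC] := key _ nS; have [D TD nD] := key _ nT.
have : ~ s (C `|` D) by move=> /cl4[].
apply; apply: cl3 => A sA; apply/discrete_extC/h => [_ -> //|t].
by move=> [/SC|/TD]; apply: clusterS (svalP t) _; [left|right].
Qed.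

Local Lemma smirnov_openT : smirnov_open setT.
Proof. by move=> s _; rewrite setCT; exact: smirnov_near0. Qed.

Local Lemma smirnov_openI : setI_closed smirnov_open.
Proof.
move=> U V oU oV s [Us Vs]; rewrite setCI => /smirnov_nearU[].
- exact: oU.
- exact: oV.
Qed.

Local Lemma smirnov_open_bigU (I : Type) (f : I -> set smirnov) :
  (forall j, smirnov_open (f j)) -> smirnov_open (\bigcup_j f j).
Proof.
move=> of_ s [j _ fs] /smirnov_nearS h; apply: (of_ j s fs); apply: h.
by move=> t nt ft; apply: nt; exists j.
Qed.

HB.instance Definition _ := gen_eqMixin smirnov.
HB.instance Definition _ := gen_choiceMixin smirnov.
HB.instance Definition _ := isOpenTopological.Build smirnov
  smirnov_openT smirnov_openI smirnov_open_bigU.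

Lemma closure_smirnov (S : set smirnov) :
  closure S = [set s | smirnov_near [set s] S].
Proof.
apply/seteqP; split=> [s clS|s nS].
  apply: contrapT => nS.
  pose N := [set t : smirnov | smirnov_near [set t] S].
  have oN : open (~` N).
    move=> t nt; rewrite setCK => h; apply: nt => A C tA SC.
    apply: h => // u nu; have [_ _ cl3 _] := svalP u.
    by apply: cl3 => D uD; apply/discrete_extC/nu => // _ ->.
  have [t [St]] := clS (~` N) (open_nbhs_nbhs (conj oN nS)).
  apply => A C tA SC; have [_ cl2 _ _] := svalP t.
  by apply: cl2; [exact: tA|exact: SC].
move=> B; rewrite nbhsE => -[U [oU Us] UB].
apply: contrapT => SB0; apply: (oU s Us); apply: smirnov_nearS nS => t St Ut.
by apply: SB0; exists t; split=> //; exact: UB.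
Qed.

Lemma point_cluster_subproof x : is_cluster [set A | A x].
Proof.
split=> [A Ax|A B Ax Bx|C h|A B []].
- by exists x.
- by left; exists x.
- have [[y [Cy yx]]|] := h [set x] erefl; first by rewrite -yx.
  by move=> /cnear_unbdd[_]; case; exact: bdd1.
- by left.
- by right.
Qed.

Definition point_cluster (x : X) : smirnov :=
  exist _ _ (point_cluster_subproof x).

Definition boundary : set smirnov :=
  [set s | forall A, sval s A -> ~ bdd P A].

(* closure_point_clusters identifies this closure with {s | A \in s}. *)
Definition trace (A : set X) : set boundary :=
  set_val @^-1` closure (point_cluster @` A).

Lemma closure_point_clusters A :
  closure (point_cluster @` A) = [set s | sval s A].
Proof.
rewrite closure_smirnov; apply/seteqP; split=> [s h|s sA D C sD AC].
  have [_ _ cl3 _] := svalP s; apply: cl3 => D sD; apply: discrete_extC.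
  by apply: h => [t ->|_ [x Ax <-]].
have [_ cl2 _ _] := svalP s.
have sub : A `<=` C.
  by move=> x Ax; apply: (AC (point_cluster x)); exists x.
exact: discrete_extS (cl2 _ _ (sD _ erefl) sA).
Qed.

End Smirnov.

Arguments boundary {X} P.
Arguments trace {X} P A.

(* Disjointness of A and B follows from the existence of a separator. *)
Definition separator (T : topologicalType) (A B C : set T) : Prop :=
  exists U V : set T,
    [/\ open U, open V, U `&` V = set0, ~` C = U `|` V & A `<=` U /\ B `<=` V].

(* The predicates below are indexed by k = n + 1, so that k = 0 is dimension
   at most -1. *)
Fixpoint Ind_lt (k : nat) (T : topologicalType) : Prop :=
  if k is k'.+1 then
    forall A B : set T, closed A -> closed B -> A `&` B = set0 ->
      exists2 C : set T, separator A B C & Ind_lt k' (set_type C)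
  else [set: T] = set0.

Definition asymptotic_separator (X : Type) (P : coarse_proximity X)
  (A B C : set X) : Prop := separator (trace P A) (trace P B) (trace P C).

Fixpoint asInd_lt (k : nat) (X : Type) (P : coarse_proximity X) : Prop :=
  if k is k'.+1 then
    forall A B : set X, ~ cnear P A B ->
      exists2 C : set X, asymptotic_separator P A B C &
        asInd_lt k' (subspace_proximity P C)
  else bdd P [set: X].

(* The least n with dimension at most n is k - 1 for the least k with lt k. *)
Definition least_dim (lt : nat -> Prop) : \bar int :=
  if pselect (exists k, `[< lt k >]) is left h
  then ((ex_minn h)%:Z - 1)%:E else +oo%E.

Definition Ind (T : topologicalType) : \bar int :=
  least_dim (fun k => Ind_lt k T).

Definition asInd (X : Type) (P : coarse_proximity X) : \bar int :=
  least_dim (fun k => asInd_lt k P).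

(* Main.v *)
Require Import Defs.
From mathcomp Require Import all_boot all_order all_algebra.
From mathcomp Require Import all_classical all_reals all_analysis.
Import Order.TTheory GRing.Theory Num.Theory.
Import numFieldNormedType.Exports.

Set Implicit Arguments.
Unset Strict Implicit.
Unset Printing Implicit Defensive.

Local Open Scope classical_set_scope.

(** Put Z for the remainder. A cluster s without bounded sets converges to a
    point z of Z, and s then consists of the sets A whose closure in Y contains
    z. This identifies the boundary with Z, and the trace of A with the limit
    set of A, the intersection of Z and the closure of A; it gives the second
    equality (boundary_pt_embedding, range_boundary_pt). The same holds for
    every subset C of X with its subspace structure: its boundary is the limit
    set of C.

    For the first equality, both dimensions are compared with a recursion on
    subsets of the fixed space Y.

    Given disjoint closed sets in the limit set K of C, normality of Y gives
    open neighbourhoods with disjoint closures, and the points of C in these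
    neighbourhoods form two sets which are not near. An asymptotic separator of
    the latter induces a separator of the former, so Ind(K) <= asInd(C)
    (asInd_lt_relInd).

    Conversely, a separator L in K is the limit set of some subset of C only if
    C is rich enough: if C is the set of natural numbers and K its remainder in
    the Stone-Cech compactification, only the clopen subsets of K arise. Let H be
    the homotopy of the Z-set property and D(L) the image of L x (0,1] under H.
    This lies in X and its limit set is exactly L (Zset_collar), and D is
    monotone. So if C contains D(K), then D(L) is an asymptotic separator inside
    C, and D(L) in turn contains D(M) for all M inside L; the induction goes
    through for the sets containing the collar of their limit set
    (relInd_lt_asInd_lt). The whole space X is one of them. *)

(** * Inductive dimension of subsets of a fixed space *)

Definition rel_separator (Y : topologicalType) (K A B C : set Y) : Prop :=
  exists U V : set Y,
    [/\ open U, open V, K `&` U `&` V = set0, K `\` C = K `&` (U `|` V) &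
      K `&` A `<=` U /\ K `&` B `<=` V].

(** Ind of the subspace K, written with closed and open sets of Y only. In this
    form a homeomorphism, or an iterated subtype, costs nothing: only the image
    in Y counts. *)
Fixpoint relInd_lt (Y : topologicalType) (k : nat) (K : set Y) : Prop :=
  if k is k'.+1 then
    forall A B : set Y, closed A -> closed B -> K `&` A `&` B = set0 ->
      exists2 C : set Y, rel_separator K A B C & relInd_lt k' (K `&` C)
  else K = set0.

Lemma range_preimageK (T Y : Type) (g : T -> Y) (C : set Y) :
  g @` (g @^-1` C) = range g `&` C.
Proof.
apply/seteqP; split=> [_ [x Cx <-]|_ [[x _ <-] Cx]]; last by exists x.
by split=> //; exists x.
Qed.

Lemma preimage_imageK (T Y : Type) (g : T -> Y) (C : set T) :
  injective g -> g @^-1` (g @` C) = C.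
Proof.
move=> ginj; apply/seteqP; split=> [x [y Cy /ginj <-]//|x Cx]; by exists x.
Qed.

Section Embeddings.
Variables (T Y : topologicalType).
Implicit Types g : T -> Y.

Lemma embedding_separator g A B C : embedding g ->
  separator (g @^-1` A) (g @^-1` B) (g @^-1` C) <->
  rel_separator (range g) A B C.
Proof.
move=> [ginj gopen]; split.
- move=> [_ [_ [/gopen[U oU <-] /gopen[V oV <-] UV CUV [AU BV]]]].
  exists U, V; split=> //.
  + apply/seteqP; split=> // _ [[[x _ <-] Ux] Vx].
    by have : set0 x by rewrite -UV.
  + apply/seteqP; split=> _ [[x _ <-] h]; split; try by exists x.
      have : (~` (g @^-1` C)) x by [].
      by rewrite CUV.
    have : (g @^-1` U `|` g @^-1` V) x by [].
    by rewrite -CUV.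
  + by split=> _ [[x _ <-] h]; [exact: AU|exact: BV].
- move=> [U [V [oU oV UV CUV [AU BV]]]].
  have gr x : range g (g x) by exists x.
  exists (g @^-1` U), (g @^-1` V); split.
  + by apply/gopen; exists U.
  + by apply/gopen; exists V.
  + apply/seteqP; split=> // x [Ux Vx].
    by have : set0 (g x) by rewrite -UV.
  + apply/seteqP; split=> x h.
      have : (range g `\` C) (g x) by [].
      by rewrite CUV => -[].
    have : (range g `&` (U `|` V)) (g x) by [].
    by rewrite -CUV => -[].
  + by split=> x h; [apply: AU|apply: BV].
Qed.

Lemma embedding_closed g A : embedding g -> closed A ->
  exists2 A' : set Y, closed A' & A = g @^-1` A'.
Proof.
move=> [_ gopen] cA; have /gopen[U oU UA] : open (~` A) by exact: closed_openC.
by exists (~` U); [exact: open_closedC|rewrite -preimage_setC UA setCK].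
Qed.

Lemma embedding_preimage_closed g A : embedding g -> closed A ->
  closed (g @^-1` A).
Proof.
move=> [_ gopen] cA; rewrite -(setCK A) preimage_setC; apply: open_closedC.
by apply/gopen; exists (~` A) => //; exact: closed_openC.
Qed.

Lemma embedding_set_val (C : set T) : embedding (set_val : C -> T).
Proof.
split; first exact: val_inj.
by move=> U; split=> [[V oV VU]|[V oV VU]]; exists V.
Qed.

End Embeddings.

Lemma embedding_comp (S T Y : topologicalType) (f : S -> T) (g : T -> Y) :
  embedding f -> embedding g -> embedding (g \o f).
Proof.
move=> [finj fopen] [ginj gopen]; split; first exact: inj_comp.
move=> U; split=> [/fopen[_ /gopen[W oW <-] <-]|[W oW <-]]; first by exists W.
by apply/fopen; exists (g @^-1` W) => //; apply/gopen; exists W.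
Qed.

Lemma range_comp_set_val (T Y : Type) (f : T -> Y) (C : set T) :
  range (f \o (set_val : C -> T)) = f @` C.
Proof.
apply/seteqP; split=> [_ [x _ <-]|_ [x Cx <-]].
  by exists (set_val x) => //; exact: set_valP.
by exists (SigSub (mem_set Cx)).
Qed.

(** Closed sets and separators of T are preimages of those of Y, and a separator
    C of T is itself embedded in Y, with range the image of C. *)
Lemma Ind_lt_embedding k (T Y : topologicalType) (g : T -> Y) : embedding g ->
  Ind_lt k T <-> relInd_lt k (range g).
Proof.
elim: k T g => [|k IH] T g eg /=.
  split=> [->|]; first by rewrite image_set0.
  by move=> /image_set0_set0.
have IHC (C : set T) : Ind_lt k C <-> relInd_lt k (g @` C).
  rewrite -range_comp_set_val; apply: IH.
  exact: embedding_comp (embedding_set_val C) eg.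
split=> h A B.
- move=> cA cB AB.
  have [|C sC iC] := h _ _ (embedding_preimage_closed eg cA)
    (embedding_preimage_closed eg cB).
    apply/seteqP; split=> // x [Ax Bx].
    have : (range g `&` A `&` B) (g x) by split=> //; split=> //; exists x.
    by rewrite AB.
  have ginj : injective g by case: eg.
  exists (g @` C).
    by apply/(embedding_separator _ _ _ eg); rewrite (preimage_imageK _ ginj).
  rewrite -range_preimageK (preimage_imageK _ ginj).
  exact/IHC.
- move=> /(embedding_closed eg)[A' cA ->] /(embedding_closed eg)[B' cB ->] AB.
  have [|C sC iC] := h _ _ cA cB.
    apply/seteqP; split=> // _ [[[x _ <-] Ax] Bx].
    have : (g @^-1` A' `&` g @^-1` B') x by [].
    by rewrite AB.
  exists (g @^-1` C); first exact/(embedding_separator _ _ _ eg).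
  by apply/IHC; rewrite range_preimageK.
Qed.

(** * Coarse proximities seen from a compact Hausdorff space *)

Section Modelled.
Variables (Y : topologicalType) (Z : set Y).
Hypotheses (cY : compact [set: Y]) (hY : hausdorff_space Y) (cZ : closed Z).

Lemma compact_hausdorff_nbhs (y : Y) (U : set Y) : nbhs y U ->
  exists V : set Y, [/\ open V, V y & closure V `<=` U].
Proof.
move=> yU; have c1 : closed [set y].
  exact: accessible_closed_set1 (hausdorff_accessible hY) y.
have yU' : set_nbhs [set y] U by move=> _ ->.
have [W /set_nbhsP[V [oV yV VW]] WU] := compact_normal hY cY c1 yU'.
exists V; split=> //; first exact: yV.
exact: subset_trans (closureS VW) WU.
Qed.

Lemma compact_hausdorff_separated (A B : set Y) : closed A -> closed B ->
  A `&` B = set0 -> exists U V : set Y,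
    [/\ open U, open V, A `<=` U, B `<=` V & closure U `&` closure V = set0].
Proof.
move=> cA cB AB.
have sep (A' B' : set Y) : closed A' -> closed B' -> A' `&` B' = set0 ->
    exists U, [/\ open U, A' `<=` U & closure U `&` B' = set0].
  move=> cA' cB' AB'.
  have nB' : set_nbhs A' (~` B').
    apply/set_nbhsP; exists (~` B'); split=> //; first exact: closed_openC.
    exact/disjoints_subset.
  have [W /set_nbhsP[U [oU AU UW]] WB] := compact_normal hY cY cA' nB'.
  exists U; split=> //; apply/disjoints_subset.
  exact: subset_trans (closureS UW) WB.
have [U [oU AU UB]] := sep _ _ cA cB AB.
have [|V [oV BV VU]] := sep B (closure U) cB (@closed_closure _ U).
  by rewrite setIC.
by exists U, V; split=> //; rewrite setIC.
Qed.

Definition limit_set (T : Type) (f : T -> Y) (A : set T) : set Y :=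
  closure (f @` A) `&` Z.

(** The coarse proximity structure that f pulls back from the compact space Y
    and its closed subset Z. The map f replaces an inclusion because subspaces
    of subspaces are nested subtypes: for them, only the composite map to Y
    matters. *)
Definition modelled (T : Type) (Q : coarse_proximity T) (f : T -> Y) : Prop :=
  (forall A, bdd Q A <-> limit_set f A = set0) /\
  (forall A B, cnear Q A B <->
     closure (f @` A) `&` closure (f @` B) `&` Z !=set0).

Lemma modelled_subspace (T : Type) (Q : coarse_proximity T) (f : T -> Y)
  (C : set T) : modelled Q f -> modelled (subspace_proximity Q C) (f \o set_val).
Proof.
move=> [fb fn].
have im (A : set C) : (f \o set_val) @` A = f @` (set_val @` A).
  by rewrite -image_comp.
split=> [A|A B]; last by rewrite !im; exact: fn.
rewrite /limit_set im; split=> [[B bB ->]|/fb bA].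
  apply/fb; apply: bddS bB => _ [x Bx <-]; exact: Bx.
exists (set_val @` A) => //.
by rewrite preimage_imageK //; exact: val_inj.
Qed.

(** * The boundary as a subspace of the compact space *)

Section Boundary.
Variables (T : Type) (Q : coarse_proximity T) (f : T -> Y).
Hypothesis mf : modelled Q f.

Lemma cluster_setT (s : smirnov Q) : sval s [set: T].
Proof.
have [_ _ cl3 _] := svalP s; have [cl1 _ _ _] := svalP s.
by apply: cl3 => A sA; left; rewrite setTI; exact: cl1.
Qed.

(** The intersection of A and B may be nonempty and bounded. It is then not in
    the cluster s, so A can be replaced by its part outside B, and that part
    can be proximal to B only at infinity. *)
Lemma boundary_cnear (s : boundary Q) A B :
  sval (set_val s) A -> sval (set_val s) B -> cnear Q A B.
Proof.
move: s => s sA sB; have nb := set_valP s.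
have [_ cl2 _ cl4] := svalP (set_val s).
apply: contrapT => nAB.
have bAB : bdd Q (A `&` B) by apply: contrapT => /cnearI.
have [|sAB|sAB] := cl4 (A `\` B) (A `&` B).
- by rewrite setUC setUIDK.
- have [[x [[_ nBx] Bx]]//|n] := cl2 _ _ sAB sB.
  by apply: nAB; apply: cnearS n => // x [].
- exact: nb sAB bAB.
Qed.

(** The sets N whose complement has a preimage outside the cluster form a proper
    filter, although the cluster itself is not closed under intersections. Its
    cluster points are the limits sought, and they lie in Z because the preimage
    of a closed set missing Z is bounded. *)
Lemma boundary_limit (s : boundary Q) : exists2 z, Z z &
  forall N, nbhs z N -> sval (set_val s) (f @^-1` N).
Proof.
pose c := sval (set_val s); have nb := set_valP s.
have cls : is_cluster Q c := svalP (set_val s).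
have [cl1 cl2 cl3 cl4] := cls.
pose F := [set S : set Y | ~ c (f @^-1` (~` S))].
have FF : ProperFilter F.
  split; first by rewrite /F /= setC0; apply; exact: cluster_setT.
  split.
  - by rewrite /F /= setCT preimage_set0 => /cl1[].
  - by move=> S S' FS FS'; rewrite /F /= setCI preimage_setU => /cl4[].
  - move=> S S' SS' FS; apply: contra_not FS; apply: clusterS cls _ => x.
    exact/subsetC.
have [z [_ Fz]] := @cY F FF filterT.
have key N : nbhs z N -> c (f @^-1` N).
  move=> zN; apply: contrapT => nN.
  have FN : F (~` N) by rewrite /F /= setCK.
  by have [x []] := Fz _ _ FN zN.
exists z => //; apply: contrapT => nZz.
have [|V [oV Vz VZ]] := @compact_hausdorff_nbhs z (~` Z).
  by apply: open_nbhs_nbhs; split=> //; exact: closed_openC.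
apply: (nb _ (key V _)); first exact: open_nbhs_nbhs.
apply/mf.1/disjoints_subset/(subset_trans _ VZ)/closureS.
by move=> _ [x Vx <-].
Qed.

(** Maximality of clusters: membership in s is already forced by nearness at the
    limit z. *)
Lemma boundary_point (s : boundary Q) :
  exists z, Z z /\ sval (set_val s) = [set A | closure (f @` A) z].
Proof.
have [z Zz zN] := boundary_limit s; exists z; split=> //.
have [_ _ cl3 _] := svalP (set_val s).
have sz A : sval (set_val s) A -> closure (f @` A) z.
  move=> sA; rewrite ((closure_id (closure (f @` A))).1 (@closed_closure _ _)).
  move=> N /compact_hausdorff_nbhs[V [oV Vz VN]].
  have /mf.2[y [[Ay Vy] _]] : cnear Q A (f @^-1` V).
    by apply: boundary_cnear sA _; apply: zN; exact: open_nbhs_nbhs.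
  exists y; split=> //; apply: VN; apply: closureS Vy => _ [x Vx <-]//.
apply/seteqP; split=> A; first exact: sz.
move=> zA; apply: cl3 => B /sz zB; right; apply/mf.2.
by exists z.
Qed.

Definition boundary_pt (s : boundary Q) : Y := projT1 (cid (boundary_point s)).

Lemma boundary_ptZ s : Z (boundary_pt s).
Proof. by rewrite /boundary_pt; case: cid => z []. Qed.

Lemma boundary_ptP (s : boundary Q) A :
  sval (set_val s) A <-> closure (f @` A) (boundary_pt s).
Proof. by rewrite /boundary_pt; case: cid => z [_ sE] /=; rewrite sE. Qed.

(** For the maximality of this family: if z is not in the closure of the image of
    C, then the preimage of a small neighbourhood V of z belongs to the family
    and is far from C. *)
Lemma limit_cluster z : limit_set f setT z ->
  is_cluster Q [set A | closure (f @` A) z].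
Proof.
move=> [Tz Zz]; split=> [A zA|A B zA zB|C h|A B].
- have [_ [[a Aa _] _]] := zA _ (filterT : nbhs z setT).
  by exists a.
- by right; apply/mf.2; exists z.
- apply: contrapT => nC.
  have [|V [oV Vz VC]] := @compact_hausdorff_nbhs z (~` closure (f @` C)).
    apply: open_nbhs_nbhs; split=> //.
    exact/closed_openC/closed_closure.
  have fV : closure (f @` (f @^-1` V)) `<=` closure V.
    by apply: closureS => _ [x Vx <-].
  have [||/mf.2[y [[Cy Vy] _]]] := h (f @^-1` V).
  + move=> N zN; have zVN : nbhs z (V `&` N).
      by apply: filterI => //; exact: open_nbhs_nbhs.
    have [_ [[x _ <-] [Vx Nx]]] := Tz _ zVN.
    by exists (f x); split=> //; exists x.
  + move=> [x [Cx Vx]]; apply: (VC (f x)); first exact: subset_closure.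
    by apply: subset_closure; exists x.
  + exact: VC (fV _ Vy) Cy.
- by rewrite /= image_setU closureU.
Qed.

Lemma range_boundary_pt : range boundary_pt = limit_set f setT.
Proof.
apply/seteqP; split=> [_ [s _ <-]|z Kz].
  by split; [apply/boundary_ptP; exact: cluster_setT|exact: boundary_ptZ].
pose c : smirnov Q := exist _ _ (limit_cluster Kz).
have bc : boundary Q c.
  move=> A zA /mf.1 A0.
  have : limit_set f A z by split=> //; exact: Kz.2.
  by rewrite A0.
pose s : boundary Q := SigSub (mem_set bc).
exists s => //; apply: contrapT => sz.
have [|V [oV Vz Vs]] := @compact_hausdorff_nbhs z (~` [set boundary_pt s]).
  apply: open_nbhs_nbhs; split; last by move=> /= /esym.
  apply: closed_openC.
  exact: accessible_closed_set1 (hausdorff_accessible hY) _.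
have sV : sval (set_val s) (f @^-1` V).
  move=> N zN; have zVN : nbhs z (V `&` N).
    by apply: filterI => //; exact: open_nbhs_nbhs.
  have [_ [[x _ <-] [Vx Nx]]] := Kz.1 _ zVN.
  by exists (f x); split=> //; exists x.
apply: (Vs (boundary_pt s)) => //.
move/boundary_ptP : sV; apply: closureS => _ [x Vx <-]//.
Qed.

Lemma trace_boundary_pt A : trace Q A = boundary_pt @^-1` limit_set f A.
Proof.
rewrite /trace closure_point_clusters.
apply/seteqP; split=> [s /boundary_ptP As|s [As _]]; last exact/boundary_ptP.
by split=> //; exact: boundary_ptZ.
Qed.

(** By the definition of its closure operator, the Smirnov compactification has
    the sets (clusters containing C) as a base of closed sets. Such a set is the
    preimage of the closure of f(C), so open sets of the boundary come from Y;
    conversely, a neighbourhood of the point of s contains the points of all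
    clusters that avoid the preimage of the complement of N, for some smaller
    open N. *)
Lemma boundary_pt_embedding : embedding boundary_pt.
Proof.
split=> [s t st|U].
  apply: val_inj; apply: eq_sig_hprop => [c p q|]; first exact: Prop_irrelevance.
  apply/seteqP; split=> A /boundary_ptP h; apply/boundary_ptP.
    by rewrite -st.
  by rewrite st.
split=> [[W oW <-]|[V oV <-]].
- pose F := [set C : set T | forall t : smirnov Q, ~ W t -> sval t C].
  exists (~` \bigcap_(C in F) closure (f @` C)).
    apply: closed_openC; apply: closed_bigI => C _; exact: closed_closure.
  apply/seteqP; split=> s.
    move=> sF; apply: contrapT => Ws; apply: sF => C FC.
    by apply/boundary_ptP; exact: FC.
  move=> Ws sF; apply: (oW _ Ws) => A C sA FC.
  have sC : sval (set_val s) C by apply/boundary_ptP; apply: sF.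
  by right; apply: boundary_cnear (sA _ erefl) sC.
- rewrite openE => s Vs.
  have [|N [oN Ns NV]] := @compact_hausdorff_nbhs (boundary_pt s) V.
    exact: open_nbhs_nbhs.
  pose C := f @^-1` ~` N.
  pose W : set (smirnov Q) := ~` closure (@point_cluster _ Q @` C).
  rewrite /interior nbhsE; exists (set_val @^-1` W).
    split; first by exists W => //; exact/closed_openC/closed_closure.
    rewrite /= /W closure_point_clusters /= => /boundary_ptP h.
    have [_ [[x Cx <-]]] := h _ (open_nbhs_nbhs (conj oN Ns)).
    exact: Cx.
  move=> t; rewrite /= /W closure_point_clusters /= => nC.
  have [_ _ _ cl4] := svalP (set_val t).
  have [||//] := cl4 (f @^-1` N) C.
    rewrite /C preimage_setC setUv; exact: cluster_setT.
  move=> /boundary_ptP h; apply: NV; apply: closureS h => _ [x Nx <-]//.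
Qed.

Lemma asymptotic_separatorE A B C : asymptotic_separator Q A B C <->
  rel_separator (limit_set f setT) (limit_set f A) (limit_set f B)
    (limit_set f C).
Proof.
rewrite /asymptotic_separator !trace_boundary_pt -range_boundary_pt.
exact: embedding_separator boundary_pt_embedding.
Qed.

End Boundary.

(** * Comparison of the two dimensions *)

Lemma limit_setTI (T : Type) (f : T -> Y) A :
  limit_set f setT `&` limit_set f A = limit_set f A.
Proof.
by apply/setIidPr; apply: setSI; apply: closureS; exact: image_subset.
Qed.

Lemma limit_set_subspace (T : Type) (f : T -> Y) (C : set T) :
  limit_set (f \o (set_val : C -> T)) setT = limit_set f C.
Proof. by rewrite /limit_set range_comp_set_val. Qed.

Lemma closed_limit_set (T : Type) (f : T -> Y) A : closed (limit_set f A).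
Proof. by apply: closedI cZ; exact: closed_closure. Qed.

(** Limit sets detect enough pairs: disjoint closed subsets of the limit set are
    contained in the limit sets of two subsets which are not near. *)
Lemma asInd_lt_relInd k (T : Type) (Q : coarse_proximity T) (f : T -> Y) :
  modelled Q f -> asInd_lt k Q -> relInd_lt k (limit_set f setT).
Proof.
elim: k T Q f => [|k IH] T Q f mf /= hQ; first exact/mf.1.
move=> A B clA clB AB; set K := limit_set f setT.
have cK : closed K by exact: closed_limit_set.
have [||/=|U [V [oU oV AU BV UV]]] :=
  @compact_hausdorff_separated (K `&` A) (K `&` B).
- exact: closedI.
- exact: closedI.
- by rewrite setIACA setIid setIA.
have lim W : open W -> K `&` W `<=` limit_set f (f @^-1` W).
  move=> oW z [[Tz Zz] Wz]; split=> // N zN.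
  have zWN : nbhs z (W `&` N).
    by apply: filterI => //; exact: open_nbhs_nbhs.
  have [_ [[x _ <-] [Wx Nx]]] := Tz _ zWN.
  by exists (f x); split=> //; exists x.
have [|C /(asymptotic_separatorE mf) [U' [V' [oU' oV' dUV CUV [AU' BV']]]] iC] :=
    hQ (f @^-1` U) (f @^-1` V).
  move=> /mf.2[y [[Uy Vy] _]].
  have : (closure U `&` closure V) y.
    by split; [apply: closureS Uy|apply: closureS Vy] => _ [x ? <-].
  by rewrite UV.
exists (limit_set f C); last first.
  rewrite limit_setTI -limit_set_subspace; apply: IH iC.
  exact: modelled_subspace.
exists U', V'; split=> //; split=> z Kz.
  apply: AU'; split; first by case: Kz.
  by apply: lim => //; split; [case: Kz|exact: AU].
apply: BV'; split; first by case: Kz.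
by apply: lim => //; split; [case: Kz|exact: BV].
Qed.

(** The induction needs the separator to be again a set that contains the collar
    of its limit set; f^-1(D L) is one, since its limit set is L and its image
    is D L. *)
Lemma relInd_lt_asInd_lt (D : set Y -> set Y) k (T : Type)
    (Q : coarse_proximity T) (f : T -> Y) :
  {homo D : L M / L `<=` M} ->
  (forall L, closed L -> L `<=` Z -> closure (D L) `&` Z = L) ->
  modelled Q f -> D (limit_set f setT) `<=` range f ->
  relInd_lt k (limit_set f setT) -> asInd_lt k Q.
Proof.
move=> Dmono DZ; elim: k T Q f => [|k IH] T Q f mf Df /= hK; first exact/mf.1.
move=> A B nAB; set K := limit_set f setT in Df hK.
have [||/=|C [U [V [oU oV dUV CUV [AU BV]]]] iC] :=
  hK (limit_set f A) (limit_set f B).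
- exact: closed_limit_set.
- exact: closed_limit_set.
- apply/seteqP; split=> // z [[_ [Az Zz]] [Bz _]].
  by apply: nAB; apply/mf.2; exists z.
set L := K `&` C in iC.
(* L is closed, being what the open sets U and V leave of K. *)
have LE : L = K `\` (U `|` V).
  apply/seteqP; split=> z [Kz h]; split=> //.
    move=> UVz; have : (K `&` (U `|` V)) z by [].
    by rewrite -CUV => -[_]; exact.
  apply: contrapT => nC; apply: h.
  have : (K `\` C) z by [].
  by rewrite CUV => -[].
have cL : closed L.
  rewrite LE; apply: closedI; first exact: closed_limit_set.
  exact/open_closedC/openU.
have LZ : L `<=` Z by move=> z [[]].
have DLf : D L `<=` range f.
  by apply: subset_trans Df; apply: Dmono => z [].
have limC : limit_set f (f @^-1` D L) = L.
  rewrite /limit_set -[RHS]DZ //; congr (closure _ `&` _).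
  by rewrite range_preimageK; exact/setIidPr.
exists (f @^-1` D L).
  apply/(asymptotic_separatorE mf); rewrite limC; exists U, V; split=> //.
  rewrite -CUV; apply/seteqP; split=> z [Kz h]; split=> //.
    by move=> Cz; apply: h.
  by move=> [].
apply: (IH _ _ (f \o set_val)); first exact: modelled_subspace.
- rewrite limit_set_subspace limC range_comp_set_val => y Dy.
  by have [x _ xy] := DLf _ Dy; exists x; rewrite /= ?xy.
- by rewrite limit_set_subspace limC.
Qed.

End Modelled.

(** * Collars from the Z-set property *)

(** D(L) is the image of L x (0,1] under the homotopy. Its closure lies in the
    compact image of L x [0,1], in which only time 0, that is L itself, meets Z;
    and each point of L is the limit of its own trajectory at time 0. *)
Lemma Zset_collar (R : realType) (Y : topologicalType) (Z : set Y) :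
  compact [set: Y] -> hausdorff_space Y -> Zset R Z ->
  exists D : set Y -> set Y,
    [/\ {homo D : L M / L `<=` M}, forall L, D L `<=` ~` Z &
      forall L, closed L -> L `<=` Z -> closure (D L) `&` Z = L].
Proof.
move=> cY hY [cZ [H [cH H0 HZ]]].
exists (fun L => H @` (L `*` `]0%R, 1%R])); split.
- by move=> L M LM; apply: image_subset => -[y t] [/LM].
- by move=> L _ [[y t] [_ /=]] + <-; rewrite in_itv /=; exact: HZ.
move=> L cL LZ; apply/seteqP; split=> [z [Dz Zz]|z Lz].
- have cHL : closed (H @` (L `*` `[0%R, 1%R])).
    apply: (compact_closed hY); apply: continuous_compact.
      by apply: continuous_subspaceW cH => -[y t] [].
    apply: compact_setX; last exact: segment_compact.
    by apply: (subclosed_compact cL cY).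
  have : closure (H @` (L `*` `[0%R, 1%R])) z.
    apply: closureS Dz; apply: image_subset => -[y t] [Ly /=] t01; split=> //=.
    by move: t01; rewrite !in_itv /= => /andP[/ltW -> ->].
  rewrite -(closure_id _).1 // => -[[y t] [Ly /=]].
  rewrite in_itv /= => /andP[t0 t1] yz.
  move: t0; rewrite le_eqVlt => /orP[/eqP t0|t0].
    by rewrite -yz -t0 H0.
  by case: (HZ y t); rewrite ?t0 ?t1 // yz.
- split; last exact: LZ.
  move=> N zN; rewrite -(H0 z) in zN.
  have z0 : ([set: Y] `*` `[0%R, 1%R]) (z, 0%R : R).
    by split=> //=; rewrite in_itv /= lexx ler01.
  have /= := (subspace_continuousP _ _).1 cH _ z0 N zN.
  move=> [[U W] /= [zU W0] UWN].
  have /nbhs_ballP[e /= e0 eW] : nbhs (0%R : R) W by [].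
  pose t : R := (Num.min (e / 2) 1)%R.
  have t0 : (0 < t)%R by rewrite lt_min ltr01 divr_gt0.
  have t1 : (t <= 1)%R by rewrite ge_min lexx orbT.
  have te : (t < e)%R by rewrite gt_min ltr_pdivrMr // ltr_pMr // ltr1n.
  exists (H (z, t)); split.
    by exists (z, t) => //; split=> //=; rewrite in_itv /= t0.
  apply: (UWN (z, t)); last by split=> //=; rewrite in_itv /= (ltW t0).
  split; first exact: nbhs_singleton.
  by apply: eW; rewrite /ball /= sub0r normrN gtr0_norm.
Qed.

Theorem corollary4p5 (R : realType) (X Y : topologicalType) (i : X -> Y)
    (lcX : locally_compact [set: X]) (hausX : hausdorff_space X)
    (hi : is_compactification i) (hZ : Zset R (remainder i)) :
  let P := induced_proximity lcX hi in
  asInd P = Ind (boundary P) /\ Ind (boundary P) = Ind (remainder i).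
Proof.
move=> P; set Z := remainder i in hZ *.
have [cY hY ei di] := hi.
have cZ : closed Z by case: hZ.
have mP : modelled Z P i.
  split=> [A|A B]; last by [].
  split=> [/(induced_bddP hi) bA|A0].
    by apply/disjoints_subset => y /bA ry; apply.
  apply/(induced_bddP hi) => y Ay; apply: contrapT => ry.
  by have : limit_set Z i A y by []; rewrite A0.
(* X is dense in Y. *)
have limT : limit_set Z i setT = Z.
  apply/setIidPr => y _ N; rewrite nbhsE => -[V [oV Vy] VN].
  have [|x [Vx rx]] := di V _ oV; first by exists y.
  by exists x; split=> //; exact: VN.
have [D [Dmono DZ DL]] := Zset_collar cY hY hZ.
have as_rel k : asInd_lt k P <-> relInd_lt k Z.
  rewrite -limT; split; first exact: asInd_lt_relInd.
  apply: (relInd_lt_asInd_lt cY hY cZ Dmono DL mP).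
  by move=> y /DZ; rewrite setCK.
have bd_rel k : Ind_lt k (boundary P) <-> relInd_lt k Z.
  rewrite -limT -(range_boundary_pt cY hY cZ mP).
  exact/Ind_lt_embedding/boundary_pt_embedding.
have rem_rel k : Ind_lt k Z <-> relInd_lt k Z.
  have ZE : range (set_val : Z -> Y) = Z.
    by rewrite -[RHS]image_id; exact: range_comp_set_val idfun Z.
  rewrite -[X in relInd_lt k X]ZE.
  exact/Ind_lt_embedding/embedding_set_val.
split; rewrite /asInd /Ind; congr least_dim; apply/funext => k; apply/propext.
- by rewrite as_rel bd_rel.
- by rewrite bd_rel rem_rel.
Qed.
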